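(* Let $(\mathbb{X},\mathcal{X},\mu)$ and $(\mathbb{Y},\mathcal{Y},\nu)$ be measure spaces and let $d$ be a positive integer. For every $1\leq j\leq d$ let $I_j$ be a countable totally ordered set and let $(E_j(i):i\in I_j)$ be an increasing system of sets from $\mathcal{Y}$. Take exponents $1\leq p<q\leq\infty$ and a bounded linear operator $T\colon L^p(\mathbb{Y},\mathcal{Y},\nu)\to L^q(\mathbb{X},\mathcal{X},\mu)$. Then the maximal operator $$(T_{\star}f)(x) := \sup_{(i_1,\ldots,i_d)\in I_1\times\cdots\times I_d} \big|T\big(f\mathbf{1}_{E_1(i_1)\cap\cdots\cap E_d(i_d)}\big)(x)\big|$$ is also bounded from $L^p(\mathbb{Y},\mathcal{Y},\nu)$ to $L^q(\mathbb{X},\mathcal{X},\mu)$, with operator norm satisfying $$\|T_{\star}\|_{L^p(\mathbb{Y})\to L^q(\mathbb{X})} \leq \big(1-2^{1/q-1/p}\big)^{-d}\, \|T\|_{L^p(\mathbb{Y})\to L^q(\mathbb{X})}.$$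
   Context: A system $(E_j(i):i\in I_j)$ is increasing if $i\leq i'$ in $I_j$ implies $E_j(i)\subseteq E_j(i')$. $\mathbf{1}_A$ is the indicator function of $A$. The convention $1/\infty=0$ is used. The operator norm of the (sublinear) operator $T_\star$ is the least constant $C$ with $\|T_\star f\|_{L^q(\mathbb{X})}\leq C\|f\|_{L^p(\mathbb{Y})}$ for all $f\in L^p(\mathbb{Y},\mathcal{Y},\nu)$. *)

(* Defs.v *)
From HB Require Import structures.
From mathcomp Require Import all_boot all_order all_algebra.
From mathcomp Require Import complex.
From mathcomp Require Import all_classical all_reals all_analysis.
From mathcomp Require Import measurable_realfun.

Set Implicit Arguments.
Unset Strict Implicit.
Unset Printing Implicit Defensive.

Import Order.TTheory GRing.Theory Num.Theory.
Import numFieldNormedType.Exports.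

Local Open Scope classical_set_scope.
Local Open Scope ring_scope.

(* Functions are scalar-valued over the reals or over the complex numbers; all
   notions below are uniform in this choice. *)
Variant base_field := real_field | complex_field.

Definition scalar_field (R : realType) (k : base_field) : numFieldType :=
  match k with real_field => R | complex_field => R[i] end.

(* The norm of R[i] takes its values in R[i]; this is its R-valued version. *)
Definition modulus (R : realType) (k : base_field) : scalar_field R k -> R :=
  match k return scalar_field R k -> R with
  | real_field => fun z : R => `|z|
  | complex_field => fun z : R[i] => complex.Re `|z|
  end.

Definition borel_scalar (R : realType) (k : base_field) :=
  g_sigma_algebraType (@open (scalar_field R k)).

Definition absf (R : realType) (k : base_field) (T : Type)
    (f : T -> scalar_field R k) : T -> \bar R := fun x => (modulus (f x))%:E.

Section Lp.
Context (R : realType) (k : base_field) d (T : measurableType d).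
Variables (mu : {measure set T -> \bar R}) (p : \bar R).
Local Notation K := (scalar_field R k).

(* Elements of L^p are handled through representatives. *)
Definition Lp : set (T -> K) :=
  [set f | measurable_fun setT (f : T -> borel_scalar R k) /\
           ('N[mu]_p[absf f] < +oo)%E].

End Lp.

Section operators.
Context (R : realType) (k : base_field).
Context dX (X : measurableType dX) dY (Y : measurableType dY).
Variables (mu : {measure set X -> \bar R}) (nu : {measure set Y -> \bar R}).
Variables (p q : \bar R).
Local Notation K := (scalar_field R k).

(* [S] is a (sublinear) operator with values in [0, +oo], e.g. f |-> |T f|. *)
Implicit Types (S : (Y -> K) -> (X -> \bar R)) (T : (Y -> K) -> (X -> K)).

Definition norm_bound S (C : R) :=
  0 <= C /\
  forall f, Lp nu p f -> ('N[mu]_q[S f] <= C%:E * 'N[nu]_p[absf f])%E.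

Definition bounded_operator S :=
  (forall f, Lp nu p f -> measurable_fun setT (S f)) /\
  exists C, norm_bound S C.

(* The infimum is +oo when there is no admissible constant. *)
Definition operator_norm S : \bar R :=
  ereal_inf [set C%:E | C in [set C | norm_bound S C]].

(* A linear map between the quotients by a.e. equality, given on
   representatives; the values of [T] outside of [Lp nu p] are irrelevant. *)
Record linear_operator T : Prop := LinearOperator {
  linear_operator_Lp : forall f, Lp nu p f -> Lp mu q (T f) ;
  linear_operator_ae : forall f g, Lp nu p f -> Lp nu p g ->
    f = g %[ae nu] -> T f = T g %[ae mu] ;
  linear_operator_linear : forall (a : K) f g, Lp nu p f -> Lp nu p g ->
    T (fun y => a * f y + g y) = (fun x => a * T f x + T g x) %[ae mu] }.

End operators.

Section maximal_operator.
Context (R : realType) (k : base_field) (X Y : Type).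
Local Notation K := (scalar_field R k).

(* The supremum is taken in [0, +oo]: adding 0 only matters when some [I j] is
   empty, where it gives the supremum of the empty set the value 0. *)
Definition maximal_operator (d : nat) (I : 'I_d -> Type)
    (E : forall j, I j -> set Y) (T : (Y -> K) -> (X -> K))
    (f : Y -> K) (x : X) : \bar R :=
  ereal_sup (0%E |` range (fun i : forall j, I j =>
    absf (T (fun y => f y * \1_(\bigcap_(j in setT) E j (i j)) y)) x)).

End maximal_operator.

(* Main.v *)
(* For one parameter, bisect by the mass of f: list a finite part of the chain
   in decreasing order and let E z be the last set carrying more than half of the
   mass of |f|^p (the first set if there is none).  The sets below E z live on a
   set with at most half of the mass, and the sets above E z, once E z is removed,
   live on the complement of E z, which also carries at most half of it.  Hence
     T_* f <= |T (f 1_(E z))| + max (T_* f', T_* f'')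
   with f', f'' of L^p norm at most 2^(-1/p) |f|_p and fewer sets on each side.
   As |max (a, b)|_q <= 2^(1/q) max (|a|_q, |b|_q), a constant C for smaller
   chains gives 1 + 2^(1/q-1/p) C, whose fixed point is (1 - 2^(1/q-1/p))^-1.
   Countable chains follow by monotone convergence.  Only the subadditivity of
   f |-> |T f| matters, and it passes to the maximal operator, so the chains can
   be treated one after the other, each costing one factor. *)
Require Import Defs.
From mathcomp Require Import all_boot all_order all_algebra.
From mathcomp Require Import complex ring lra.
From mathcomp Require Import all_classical all_reals all_analysis.
From mathcomp Require Import measurable_realfun ess_sup_inf.

Set Implicit Arguments.
Unset Strict Implicit.
Unset Printing Implicit Defensive.

Import Order.TTheory GRing.Theory Num.Theory.
Import numFieldNormedType.Exports.
Local Open Scope classical_set_scope.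
Local Open Scope ring_scope.

(** * Real powers on the extended nonnegative half-line *)

Section poweR_monotone.
Local Open Scope ereal_scope.
Context {R : realType}.
Implicit Types (x y : \bar R) (r : R).

Lemma le_poweR x y r : (0 <= r)%R -> 0 <= x -> x <= y -> x `^ r <= y `^ r.
Proof.
move=> r0 x0 xy; apply: gt0_ler_poweR => //; rewrite in_itv /= ?leey ?x0 //.
by rewrite (le_trans x0 xy).
Qed.

Lemma poweRK x r : (0 < r)%R -> 0 <= x -> (x `^ r) `^ r^-1 = x.
Proof. by move=> r0 x0; rewrite -poweRrM mulfV ?gt_eqF// poweRe1. Qed.

Lemma poweRVK x r : (0 < r)%R -> 0 <= x -> (x `^ r^-1) `^ r = x.
Proof. by move=> r0 x0; rewrite -poweRrM mulVf ?gt_eqF// poweRe1. Qed.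

End poweR_monotone.

(** * Norm inequalities for extended-real functions *)

Section Lnorm_ereal.
Local Open Scope ereal_scope.
Context {R : realType} d (T : measurableType d).
Variable mu : {measure set T -> \bar R}.
Implicit Types (f g : T -> \bar R) (p c : \bar R) (r : R).

(** Raising to the power [r] is an order isomorphism of the nonnegative half-line, so norm bounds
    with finite exponent become integral bounds without roots. *)
Lemma Lnorm_le_poweR f r c : (0 < r)%R -> 0 <= c ->
  ('N[mu]_r%:E[f] <= c) = (\int[mu]_x `|f x| `^ r <= c `^ r).
Proof.
move=> r0 c0; rewrite unlock.
have i0 : 0 <= \int[mu]_x `|f x| `^ r.
  by apply: integral_ge0 => x _; exact: poweR_ge0.
apply/idP/idP => h.
  by rewrite -(poweRVK r0 i0); apply: le_poweR (ltW r0) (poweR_ge0 _ _) h.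
by rewrite -(poweRK r0 c0); apply: le_poweR i0 h; rewrite invr_ge0 ltW.
Qed.

Lemma measurable_poweR_abse f r : measurable_fun setT f ->
  measurable_fun setT (fun x => `|f x| `^ r).
Proof.
move=> mf.
apply: (@measurableT_comp _ _ _ _ _ _ (fun x : \bar R => x `^ r)) => //.
  exact: (measurableT_comp (measurable_poweR _)).
exact: measurableT_comp.
Qed.

Lemma le_Lnorm_ae f g p : 0 < p ->
  measurable_fun setT f -> measurable_fun setT g ->
  (\forall x \ae mu, `|f x| <= `|g x|) -> 'N[mu]_p[f] <= 'N[mu]_p[g].
Proof.
move=> + mf mg fg; case: p => [r||//] r0; rewrite unlock; last first.
  by case: ifPn => // _; exact: le_ess_sup.
rewrite lte_fin in r0; apply: le_poweR.
- by rewrite invr_ge0 ltW.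
- by apply: integral_ge0 => x _; exact: poweR_ge0.
apply: ae_ge0_le_integral => //; try (by move=> *; exact: poweR_ge0);
  try exact: measurable_poweR_abse.
apply: filterS fg => x fg _; exact: le_poweR (ltW r0) (abse_ge0 _) fg.
Qed.

Lemma Lnorm_lty_ae_fin f p : 0 < p -> measurable_fun setT f ->
  'N[mu]_p[f] < +oo -> \forall x \ae mu, f x \is a fin_num.
Proof.
case: p => [r||//] r0 mf; rewrite unlock; last first.
  case: ifPn => [_ fy|]; last first.
    (* On a space of measure zero the norm for [+oo] is 0 by convention, and every property holds
       almost everywhere. *)
    rewrite -leNgt => mu0 _.
    exists setT; split => //; first by apply/eqP; rewrite eq_le mu0 measure_ge0.
  have := ess_sup_ge mu (abse \o f); apply: filterS => x /= fx.
  by rewrite -abse_fin_num ge0_fin_numE// (le_lt_trans fx).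
rewrite lte_fin in r0.
move=> /lty_poweRy; rewrite invr_eq0 gt_eqF// => /(_ isT) iy.
have : mu.-integrable setT (fun x => `|f x| `^ r).
  apply/integrableP; split; first exact: measurable_poweR_abse.
  by under eq_integral do rewrite gee0_abs ?poweR_ge0//.
move=> /integrable_ae-/(_ measurableT); apply: filterS => x /(_ I).
rewrite -(abse_fin_num (f x)) !ge0_fin_numE ?poweR_ge0//.
by apply: lty_poweRy; rewrite gt_eqF.
Qed.

(** An infinite norm on the right makes the bound trivial. Otherwise both functions are finite
    almost everywhere, and replacing them by their [fine] parts reduces the claim to Minkowski's
    inequality for real functions. *)
Lemma Lnorm_add_le f g p : 1 <= p ->
  measurable_fun setT f -> measurable_fun setT g ->
  'N[mu]_p[f \+ g] <= 'N[mu]_p[f] + 'N[mu]_p[g].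
Proof.
move=> p1 mf mg; have p0 : 0 < p by rewrite (lt_le_trans _ p1).
have [->|Nf] := eqVneq 'N[mu]_p[f] +oo.
  by rewrite addye ?leey// gt_eqF// (lt_le_trans _ (Lnorm_ge0 _ _ _)).
have [->|Ng] := eqVneq 'N[mu]_p[g] +oo.
  by rewrite addey ?leey// gt_eqF// (lt_le_trans _ (Lnorm_ge0 _ _ _)).
rewrite -!ltey in Nf Ng.
have ff := Lnorm_lty_ae_fin p0 mf Nf.
have fg := Lnorm_lty_ae_fin p0 mg Ng.
have mff : measurable_fun setT (fine \o f) by exact: measurableT_comp.
have mfg : measurable_fun setT (fine \o g) by exact: measurableT_comp.
have N1 : 'N[mu]_p[EFin \o (fine \o f)] <= 'N[mu]_p[f].
  apply: le_Lnorm_ae => //; first exact/measurable_EFinP.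
  by apply: filterS ff => x fx; rewrite [(EFin \o _) x]fineK.
have N2 : 'N[mu]_p[EFin \o (fine \o g)] <= 'N[mu]_p[g].
  apply: le_Lnorm_ae => //; first exact/measurable_EFinP.
  by apply: filterS fg => x fx; rewrite [(EFin \o _) x]fineK.
apply: le_trans (leeD N1 N2).
apply: le_trans (@eminkowski _ _ _ mu _ _ _ mff mfg p1).
apply: le_Lnorm_ae => //.
- exact: emeasurable_funD.
- by apply/measurable_EFinP; exact: measurable_funD.
by apply: filterS2 ff fg => x fx gx; rewrite [(EFin \o _) x]EFinD !fineK.
Qed.

(** For a finite exponent [r], [max(f, g)^r <= f^r + g^r] pointwise, so the integral at most
    doubles. For [+oo] the factor is [2^0 = 1]. *)
Lemma Lnorm_max_le f g p c : 0 < p -> 0 <= c ->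
  measurable_fun setT f -> measurable_fun setT g ->
  (forall x, 0 <= f x) -> (forall x, 0 <= g x) ->
  'N[mu]_p[f] <= c -> 'N[mu]_p[g] <= c ->
  Lnorm mu p (fun x => maxe (f x) (g x)) <= ((2 : R) `^ fine p^-1)%:E * c.
Proof.
move=> + c0 mf mg f0 g0; have mM := measurable_maxe mf mg.
case: p => [r||//] r0; last first.
  rewrite invey /= powRr0 mul1e unlock; case: ifPn => // _.
  move=> /ess_supP fc /ess_supP gc; apply/ess_supP.
  by apply: filterS2 fc gc => x /= fc gc; case: (leP (f x) (g x)).
rewrite lte_fin in r0.
have K0 : (0 <= (2 : R) `^ r^-1)%R by exact: powR_ge0.
rewrite inver gt_eqF//= !Lnorm_le_poweR ?mule_ge0 ?lee_fin// => Nf Ng.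
rewrite poweRM ?lee_fin// poweR_EFin -powRrM mulVf ?gt_eqF// powRr1//.
rewrite (_ : 2%:E = 1 + 1)// ge0_muleDl ?lee01// mul1e.
apply: le_trans (leeD Nf Ng); rewrite -ge0_integralD//; first last.
- exact: measurable_poweR_abse.
- by move=> *; exact: poweR_ge0.
- exact: measurable_poweR_abse.
- by move=> *; exact: poweR_ge0.
apply: ge0_le_integral => //.
- by move=> *; exact: poweR_ge0.
- exact: measurable_poweR_abse.
- by apply: emeasurable_funD; exact: measurable_poweR_abse.
move=> x _; case: (leP (f x) (g x)) => _.
  by rewrite leeDr ?poweR_ge0.
by rewrite leeDl ?poweR_ge0.
Qed.

Lemma measurable_ereal_sup_seq (f : nat -> T -> \bar R) :
  (forall n, measurable_fun setT (f n)) ->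
  measurable_fun setT (fun x => ereal_sup (range (f ^~ x))).
Proof.
move=> mf; have := measurable_fun_esups mf 0.
congr measurable_fun; apply/funext => x; congr ereal_sup.
by apply/seteqP; split => [_ [n _ <-]|_ [n _ <-]]; exists n.
Qed.

(** For a finite exponent this is monotone convergence applied to the powers; for [+oo] a countable
    union of null sets is discarded. It carries bounds from finite chains to countable ones. *)
Lemma Lnorm_sup_le (f : nat -> T -> \bar R) p c : 0 < p -> 0 <= c ->
  (forall n, measurable_fun setT (f n)) -> (forall n x, 0 <= f n x) ->
  (forall x, nondecreasing_seq (f ^~ x)) ->
  (forall n, 'N[mu]_p[f n] <= c) ->
  Lnorm mu p (fun x => ereal_sup (range (f ^~ x))) <= c.
Proof.
move=> + c0 mf f0 ndf; have s0 x : 0 <= ereal_sup (range (f ^~ x)).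
  by apply: le_ereal_sup_tmp; exists (f 0%N x).
case: p => [r||//] r0; last first.
  rewrite unlock; case: ifPn => // _ fc; apply/ess_supP.
  have : \forall x \ae mu, forall n, f n x <= c.
    apply: ae_foralln => n; have /ess_supP := fc n.
    by apply: filterS => x /=; rewrite gee0_abs.
  apply: filterS => x h /=; rewrite gee0_abs//.
  by apply: ge_ereal_sup => _ [n _ <-].
rewrite lte_fin in r0; rewrite Lnorm_le_poweR// => fc.
have ndp x : nondecreasing_seq (fun n => `|f n x| `^ r).
  move=> m n mn; apply: le_poweR (ltW r0) _ _ => //.
  by rewrite !gee0_abs//; exact: ndf.
have supE x :
    `|ereal_sup (range (f ^~ x))| `^ r <= limn (fun n => `|f n x| `^ r).
  rewrite (cvg_lim _ (ereal_nondecreasing_cvgn (ndp x)))//.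
  rewrite gee0_abs//; set L := ereal_sup (range (fun n => `|f n x| `^ r)).
  have L0 : 0 <= L.
    apply: le_ereal_sup_tmp; exists (`|f 0%N x| `^ r); rewrite ?poweR_ge0//.
  (* It suffices that [f n x <= L^(1/r)] for all [n], which is the root of [f n x ^ r <= L]. *)
  rewrite -[L](poweRVK r0)//; apply: le_poweR (ltW r0) (s0 x) _.
  apply: ge_ereal_sup => _ [n _ <-]; rewrite -[f n x](poweRK r0)//.
  apply: le_poweR; rewrite ?invr_ge0 ?(ltW r0) ?poweR_ge0//.
  by apply: ereal_sup_ubound; exists n => //; rewrite gee0_abs.
apply: (@le_trans _ _ (\int[mu]_x limn (fun n => `|f n x| `^ r))).
  apply: ge0_le_integral => //.
  - by move=> *; exact: poweR_ge0.
  - by apply: measurable_poweR_abse; exact: measurable_ereal_sup_seq.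
  - apply: (emeasurable_fun_cvg (fun n x => `|f n x| `^ r)).
      by move=> n; exact: measurable_poweR_abse.
    by move=> x _; exact: ereal_nondecreasing_is_cvgn.
rewrite monotone_convergence//.
- apply: lime_le; last by apply: nearW => n; rewrite -Lnorm_le_poweR.
  apply: ereal_nondecreasing_is_cvgn => m n mn.
  apply: ge0_le_integral => //.
  + by move=> *; exact: poweR_ge0.
  + exact: measurable_poweR_abse.
  + exact: measurable_poweR_abse.
  + by move=> x _; exact: ndp.
- by move=> n; exact: measurable_poweR_abse.
- by move=> *; exact: poweR_ge0.
Qed.

End Lnorm_ereal.

(** * Countable families: enumeration, null sets, suprema *)

Section countability.

(** An injection of [A] into [nat] is inverted on its image; [None] marks the numbers outside it, so
    empty and finite sets are covered too. *)
Lemma countable_enumeration (J : Type) (A : set J) : countable A ->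
  exists e : nat -> option J, A = [set j | exists n, e n = Some j].
Proof.
move=> /countable_injP[g gi].
exists (fun n => if pselect (exists j, A j /\ g j = n) is left h
                 then Some (projT1 (cid h)) else None).
apply/seteqP; split=> j /=.
  move=> Aj; exists (g j); case: pselect => [h|]; last by case; exists j.
  case: cid => i /= [Ai gij]; congr Some; apply: gi; by rewrite ?inE.
by move=> [n]; case: pselect => // h [<-]; case: cid => i /= [].
Qed.

Context d (T : measurableType d) (R : realType).

Lemma ae_forall_countable (mu : {measure set T -> \bar R}) (J : Type)
    (A : set J) (P : J -> T -> Prop) : countable A ->
  (forall j, A j -> \forall x \ae mu, P j x) ->
  \forall x \ae mu, forall j, A j -> P j x.
Proof.
move=> /countable_enumeration[e ->] AP.
have : \forall x \ae mu, forall n, oapp (P ^~ x) True (e n).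
  apply: ae_foralln => n; case en: (e n) => [j|] /=.
    by apply: AP; exists n.
  exact: aeW.
by apply: filterS => x ePx j [n enj]; have := ePx n; rewrite enj.
Qed.

Lemma measurable_ereal_sup_countable (J : Type) (A : set J)
    (f : J -> T -> \bar R) : countable A ->
  (forall j, A j -> measurable_fun setT (f j)) ->
  measurable_fun setT (fun x => ereal_sup (0%E |` [set f j x | j in A])).
Proof.
move=> /countable_enumeration[e ->] mf.
(* Index 0 is reserved for the adjoined value 0; the enumeration is shifted by one. *)
pose u n x := if n is n'.+1 then oapp (f ^~ x) 0%E (e n') else 0%E.
have -> : (fun x => ereal_sup (0%E |` [set f j x | j in
    [set j | exists n, e n = Some j]])) = (fun x => ereal_sup (range (u ^~ x))).
  apply/funext => x; congr ereal_sup; apply/seteqP; split => y /=.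
    case=> [->|[j [n enj] <-]]; first by exists 0%N.
    by exists n.+1 => //=; rewrite enj.
  case=> [[|n] _ <-] /=; first by left.
  by case en: (e n) => [j|] /=; [right; exists j => //; exists n | left].
apply: measurable_ereal_sup_seq => -[|n]; first exact: measurable_cst.
rewrite /u; case en: (e n) => [j|] /=; last exact: measurable_cst.
by apply: mf; exists n.
Qed.

End countability.

(** * The real-valued modulus on both scalar fields *)

Section modulus_properties.
Context (R : realType).
Local Open Scope complex_scope.

Lemma modulus0 k : modulus (0 : scalar_field R k) = 0.
Proof. by case: k; rewrite /modulus normr0. Qed.

Lemma modulus_ge0 k (z : scalar_field R k) : 0 <= modulus z.
Proof.
case: k z => //= z; have := normr_ge0 z; by rewrite lecE /= => /andP[].
Qed.

Lemma modulusD k (z w : scalar_field R k) :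
  modulus (z + w) <= modulus z + modulus w.
Proof.
case: k z w => /= z w; first exact: ler_normD.
by have := ler_normD z w; rewrite lecE => /andP[_]; rewrite raddfD.
Qed.

(** Comparison in [R[i]] asks for equal imaginary parts; both sides being real here, it reduces to
    real parts. Thus the sublevel sets of [modulus] are balls, hence open, which gives its
    measurability. *)
Lemma modulus_lt k (r : R) : exists e : scalar_field R k,
  forall z, (modulus z < r) = (`|z| < e).
Proof.
case: k; first by exists r.
by exists r%:C => z; rewrite ltcE /= eqxx.
Qed.

Lemma measurable_modulus k d (T : measurableType d)
    (f : T -> scalar_field R k) :
  measurable_fun setT (f : T -> borel_scalar R k) ->
  measurable_fun setT (absf f).
Proof.
move=> mf; apply/measurable_EFinP.
apply: (measurability _ (RGenInftyO.measurableE R)) => // _ [_ [r ->] <-].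
have [e eE] := modulus_lt k r.
have -> : (fun x => modulus (f x)) @^-1` `]-oo, r[%classic = f @^-1` (ball 0 e).
  by apply/seteqP; split=> x /=;
    rewrite in_itv /= eE -ball_normE /ball_ /= sub0r normrN.
apply: mf => //; apply: sub_sigma_algebra; exact: ball_open.
Qed.

End modulus_properties.

(** * Cutoffs [f 1_A] and their norms *)

Section cutoffs.
Context (R : realType) (k : base_field).
Local Notation K := (scalar_field R k).

(** This unfolds to the very product that appears inside [maximal_operator]. *)
Definition cutoff (Y : Type) (f : Y -> K) (A : set Y) : Y -> K :=
  fun y => f y * \1_A y.

Lemma cutoffE (Y : Type) (f : Y -> K) A y :
  cutoff f A y = if y \in A then f y else 0.
Proof. by rewrite /cutoff indicE; case: (y \in A); rewrite ?mulr1 ?mulr0. Qed.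

Lemma cutoffI (Y : Type) (f : Y -> K) A B :
  cutoff (cutoff f A) B = cutoff f (A `&` B).
Proof. by apply/funext => y; rewrite /cutoff indicI mulrA. Qed.

Lemma cutoffT (Y : Type) (f : Y -> K) : cutoff f setT = f.
Proof. by apply/funext => y; rewrite /cutoff indicT mulr1. Qed.

Lemma cutoffD (Y : Type) (f g : Y -> K) A :
  cutoff (fun y => f y + g y) A = fun y => cutoff f A y + cutoff g A y.
Proof. by apply/funext => y; rewrite /cutoff mulrDl. Qed.

Lemma cutoff_split (Y : Type) (f : Y -> K) A B : A `<=` B ->
  cutoff f B = fun y => cutoff f A y + cutoff (cutoff f (~` A)) B y.
Proof.
move=> AB; apply/funext => y; rewrite !cutoffE in_setC.
have [yA|yA] /= := boolP (y \in A).
  by rewrite if_same addr0 mem_set //; apply: AB; exact: set_mem.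
by rewrite add0r.
Qed.

Lemma absf_cutoff (Y : Type) (f : Y -> K) A y :
  absf (cutoff f A) y = if y \in A then absf f y else 0%E.
Proof. by rewrite /absf cutoffE; case: ifP => // _; rewrite modulus0. Qed.

Local Open Scope ereal_scope.
Context dY (Y : measurableType dY) (nu : {measure set Y -> \bar R}).
Implicit Types (f : Y -> K) (A B : set Y) (p : \bar R).

Lemma absf_ge0 (f : Y -> K) y : 0 <= absf f y.
Proof. by rewrite lee_fin modulus_ge0. Qed.

Lemma measurable_absf p f : Lp nu p f -> measurable_fun setT (absf f).
Proof. by move=> [mf _]; exact: measurable_modulus. Qed.

Lemma measurable_cutoff f A : measurable A ->
  measurable_fun setT (f : Y -> borel_scalar R k) ->
  measurable_fun setT (cutoff f A : Y -> borel_scalar R k).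
Proof.
move=> mA mf.
have -> : (cutoff f A : Y -> borel_scalar R k) =
    (fun y => if y \in A then f y else 0%R).
  by apply/funext => y; rewrite cutoffE.
apply: measurable_fun_ifT => //.
apply: (measurable_fun_bool true).
rewrite setTI (_ : _ @^-1` _ = A)//.
by apply/seteqP; split => y /=; [exact: set_mem|exact: mem_set].
Qed.

Lemma Lnorm_cutoff_le p f A B : 0 < p -> measurable A -> measurable B ->
  A `<=` B -> Lp nu p f ->
  'N[nu]_p[absf (cutoff f A)] <= 'N[nu]_p[absf (cutoff f B)].
Proof.
move=> p0 mA mB AB [mf _]; apply: le_Lnorm_ae => //.
- by apply: measurable_modulus; exact: measurable_cutoff.
- by apply: measurable_modulus; exact: measurable_cutoff.
apply: aeW => y; rewrite !absf_cutoff; case: ifPn => yA.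
  by rewrite mem_set //; apply: AB; exact: set_mem.
by rewrite abse0 abse_ge0.
Qed.

Lemma Lp_cutoff p f A : 0 < p -> measurable A -> Lp nu p f ->
  Lp nu p (cutoff f A).
Proof.
move=> p0 mA Lf; have [mf Nf] := Lf; split; first exact: measurable_cutoff.
have := Lnorm_cutoff_le p0 mA measurableT (@subsetT _ A) Lf.
by rewrite cutoffT => /le_lt_trans; exact.
Qed.

Lemma integral_cutoff (r : R) f A : (0 < r)%R -> measurable A ->
  \int[nu]_y `|absf (cutoff f A) y| `^ r = \int[nu]_(y in A) `|absf f y| `^ r.
Proof.
move=> r0 mA; rewrite [RHS]integral_mkcond; apply: eq_integral => y _.
rewrite absf_cutoff patchE; case: ifP => // _.
by rewrite abse0 poweR0r// gt_eqF.
Qed.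

(** The integrals of [|f|^p] over [A] and its complement add up to the total, so one of them is at
    most half of it; the root of [1/2] is the factor [2^(-1/p)]. *)
Lemma Lnorm_cutoff_half p f A : 1 <= p -> p < +oo -> measurable A ->
  Lp nu p f ->
  'N[nu]_p[absf (cutoff f A)] <= (2 `^ (- fine p^-1))%:E * 'N[nu]_p[absf f] \/
  'N[nu]_p[absf (cutoff f (~` A))] <=
    (2 `^ (- fine p^-1))%:E * 'N[nu]_p[absf f].
Proof.
case: p => [r||//] // r1 _ mA Lf; have [mf Nf] := Lf.
have r0 : (0 < r)%R by rewrite -lte_fin (lt_le_trans _ r1).
have mAc : measurable (~` A) by exact: measurableC.
have mpf : measurable_fun setT (fun y => `|absf f y| `^ r).
  by apply: measurable_poweR_abse; exact: measurable_absf Lf.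
rewrite inver gt_eqF//=.
have c0 : 0 <= (2 `^ (- r^-1))%:E * 'N[nu]_r%:E[absf f].
  by apply: mule_ge0; [rewrite lee_fin powR_ge0|exact: Lnorm_ge0].
rewrite !Lnorm_le_poweR// !integral_cutoff//.
rewrite poweRM ?lee_fin ?powR_ge0 ?Lnorm_ge0//.
rewrite poweR_EFin -powRrM mulNr mulVf ?gt_eqF//.
rewrite powR_inv1// poweR_Lnorm ?gt_eqF//.
have -> : \int[nu]_y `|absf f y| `^ r =
    \int[nu]_(y in A) `|absf f y| `^ r + \int[nu]_(y in ~` A) `|absf f y| `^ r.
  rewrite -ge0_integral_setU ?setUCr//.
  - by move=> *; exact: poweR_ge0.
  - by apply/disj_setPS; rewrite setICr.
(* Membership in [Lp] makes all these masses finite, so the comparison takes place in the reals. *)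
have sub B : measurable B -> \int[nu]_(x in B) `|absf f x| `^ r \is a fin_num.
  move=> mB; rewrite ge0_fin_numE; last first.
    by apply: integral_ge0 => *; exact: poweR_ge0.
  apply: (@le_lt_trans _ _ (\int[nu]_x `|absf f x| `^ r)).
    by apply: ge0_subset_integral => // *; exact: poweR_ge0.
  by rewrite -poweR_Lnorm ?gt_eqF//; exact: poweR_lty.
rewrite -(fineK (sub A mA)) -(fineK (sub (~` A) mAc)) -EFinD -EFinM !lee_fin.
by case: (leP (fine (\int[nu]_(x in A) `|absf f x| `^ r))
  (fine (\int[nu]_(x in ~` A) `|absf f x| `^ r))) => ?; [left|right]; lra.
Qed.

End cutoffs.

(** In a decreasing list the light indices form a final segment; [x] is the last heavy index, or the
    head if there is none. Only the head of [s1] is tested, as it dominates the rest of [s1]. *)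
Lemma pairwise_split_light d (I : orderType d) (light : pred I) (s : seq I) :
  (forall i j, (j <= i)%O -> light i -> light j) ->
  pairwise (fun i j => (j <= i)%O) s -> s != [::] ->
  exists s2 x s1, [/\ s = s2 ++ x :: s1, s2 = [::] \/ ~~ light x &
    forall y s', s1 = y :: s' -> light y].
Proof.
move=> mono; elim: s => // x s IH /= /andP[/allP xs ps] _.
have [lx|nlx] := boolP (light x).
  exists [::], x, s; split=> //; first by left.
  move=> y s' sE; apply: mono lx; apply: xs; by rewrite sE mem_head.
case: s => [|z s] in IH xs ps *.
  by exists [::], x, [::]; split => //; left.
have [zx|nz] := boolP (light z).
  exists [::], x, (z :: s); split=> //; first by left.
  by move=> y s' [<-].
have [s2 [w [s1 [sE s2w h]]]] := IH ps isT.
exists (x :: s2), w, s1; split => //; first by rewrite sE.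
(* An empty prefix in the recursive split means [w = z], which is heavy. *)
case: s2w => [s20|]; last by right.
by right; move: sE; rewrite s20 => -[<- _].
Qed.

(** * Sublinear operators and suprema over the cutoffs of one chain *)

Section maximal.
Context (R : realType) (k : base_field).
Context dX (X : measurableType dX) dY (Y : measurableType dY).
Variables (mu : {measure set X -> \bar R}) (nu : {measure set Y -> \bar R}).
Variables (p q : \bar R).
Hypotheses (p1 : (1 <= p)%E) (pq : (p < q)%E).
Local Notation K := (scalar_field R k).
Local Open Scope ereal_scope.

(** These properties of [f |-> |T f|] survive suprema over countably many cutoffs, which allows
    iteration. Subadditivity holds only almost everywhere because [T] acts on representatives. *)
Record sublinear (S : (Y -> K) -> X -> \bar R) : Prop := Sublinear {
  sublinear_measurable : forall f, Lp nu p f -> measurable_fun setT (S f) ;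
  sublinear_ge0 : forall f x, 0 <= S f x ;
  sublinear_add : forall f g, Lp nu p f -> Lp nu p g ->
    \forall x \ae mu, S (fun y => f y + g y)%R x <= S f x + S g x }.

(** The index set [J] is a parameter so that finite lists and the whole chain are treated alike; the
    adjoined 0 is the value for empty [J]. *)
Definition sup_cutoff (I : Type) (E : I -> set Y) (J : set I)
    (S : (Y -> K) -> X -> \bar R) (f : Y -> K) (x : X) : \bar R :=
  ereal_sup (0 |` [set S (cutoff f (E i)) x | i in J]).

Section sup_cutoffs.
Context (I : Type) (E : I -> set Y).
Hypothesis mE : forall i, measurable (E i).
Variable S : (Y -> K) -> X -> \bar R.
Implicit Types (J : set I) (f : Y -> K).

Lemma sup_cutoff_le J f x c : 0 <= c ->
  (forall i, J i -> S (cutoff f (E i)) x <= c) -> sup_cutoff E J S f x <= c.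
Proof.
move=> c0 Sc; apply: ge_ereal_sup => _ [->//|[i Ji <-]]; exact: Sc.
Qed.

Lemma le_sup_cutoff J f x i : J i ->
  S (cutoff f (E i)) x <= sup_cutoff E J S f x.
Proof. by move=> Ji; apply: ereal_sup_ubound; right; exists i. Qed.

Lemma sup_cutoff_ge0 J f x : 0 <= sup_cutoff E J S f x.
Proof. by apply: ereal_sup_ubound; left. Qed.

Lemma p_gt0 : 0 < p. Proof. exact: lt_le_trans p1. Qed.
Lemma q_gt0 : 0 < q. Proof. exact: lt_trans p_gt0 pq. Qed.

Hypothesis sS : sublinear S.

Lemma measurable_sup_cutoff J f : countable J -> Lp nu p f ->
  measurable_fun setT (sup_cutoff E J S f).
Proof.
move=> cJ Lf; apply: measurable_ereal_sup_countable => // i _.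
by apply: (sublinear_measurable sS); apply: Lp_cutoff => //; exact: p_gt0.
Qed.

(** Outside a countable union of null sets each cutoff obeys subadditivity, and a supremum of sums
    is at most the sum of the suprema. *)
Lemma sublinear_sup_cutoff J : countable J -> sublinear (sup_cutoff E J S).
Proof.
move=> cJ; split.
- by move=> f; exact: measurable_sup_cutoff.
- by move=> f x; exact: sup_cutoff_ge0.
move=> f g Lf Lg.
have : \forall x \ae mu, forall i, J i ->
    S (fun y => cutoff f (E i) y + cutoff g (E i) y)%R x <=
    S (cutoff f (E i)) x + S (cutoff g (E i)) x.
  apply: ae_forall_countable => // i _.
  by apply: (sublinear_add sS); apply: Lp_cutoff => //; exact: p_gt0.
apply: filterS => x h; apply: sup_cutoff_le.
  by rewrite adde_ge0 ?sup_cutoff_ge0.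
move=> i Ji; rewrite cutoffD; apply: le_trans (h i Ji) _.
by apply: leeD; exact: le_sup_cutoff.
Qed.

End sup_cutoffs.

(** The solution of [C = 1 + 2^(1/q-1/p) C]. For [q = +oo], [fine q^-1] is 0, in line with
    [1/oo = 0]. *)
Definition ck_const : R := (1 - 2 `^ (fine q^-1 - fine p^-1))^-1.

Lemma powR_exponents_lt1 : (2 `^ (fine q^-1 - fine p^-1) < 1 :> R)%R.
Proof.
have h : (fine q^-1 < fine p^-1 :> R)%R.
  move: p1 pq; case: p => [r||//]; last by move=> _; rewrite ltNge leey.
  rewrite lee_fin => r1.
  have r0 : (0 < r)%R by rewrite (lt_le_trans _ r1).
  case: q => [s||//] rs; last by rewrite invey inver gt_eqF//= invr_gt0.
  rewrite lte_fin in rs; have s0 := lt_trans r0 rs.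
  by rewrite !inver !gt_eqF//= ltf_pV2// posrE.
rewrite /powR pnatr_eq0 /= -[ltRHS]expR0 ltr_expR.
by rewrite pmulr_llt0 ?subr_lt0// ln_gt0 ?ltr1n.
Qed.

Lemma ck_const_gt0 : (0 < ck_const)%R.
Proof. by rewrite invr_gt0 subr_gt0 powR_exponents_lt1. Qed.

(** * The maximal bound for one chain *)

Section chain.
Context disp (I : orderType disp) (E : I -> set Y).
Hypothesis mE : forall i, measurable (E i).
Hypothesis incrE : forall i j, (i <= j)%O -> E i `<=` E j.
Variable S : (Y -> K) -> X -> \bar R.
Hypothesis sS : sublinear S.
Variable A : R.
Hypothesis normS : norm_bound mu nu p q S A.

(** Induction on a bound for the length, because the bisection leaves two strictly shorter lists.
    The function varies, since the induction hypothesis is applied to cutoffs of [f]. *)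
Lemma norm_sup_cutoff_seq n (s : seq I) f : (size s <= n)%N ->
  pairwise (fun i j => (j <= i)%O) s -> Lp nu p f ->
  'N[mu]_q[sup_cutoff E [set` s] S f] <=
    (ck_const * A)%:E * 'N[nu]_p[absf f].
Proof.
have [A0 SA] := normS; have p0 := p_gt0; have q0 := q_gt0.
have C0 := ck_const_gt0.
have bd0 (g : Y -> K) : 0 <= (ck_const * A)%:E * 'N[nu]_p[absf g].
  by apply: mule_ge0; [rewrite lee_fin mulr_ge0// ltW|exact: Lnorm_ge0].
have N0 g : 'N[mu]_q[sup_cutoff E [set` [::]] S g] = 0.
  rewrite -[RHS](Lnorm0 mu (p := q)) ?gt_eqF//; apply: eq_Lnorm => x.
  apply/eqP; rewrite eq_le sup_cutoff_ge0 andbT; apply: sup_cutoff_le => //.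
elim: n s f => [|n IH] s f.
  by rewrite leqn0 size_eq0 => /eqP -> _ _; rewrite N0.
have [->|s0] := eqVneq s [::]; first by rewrite N0.
move=> sn ps Lf.
(* The norm that corresponds to half of the mass of [|f|^p]. *)
pose c := (2 `^ (- fine p^-1))%:E * 'N[nu]_p[absf f].
pose light i := 'N[nu]_p[absf (cutoff f (E i))] <= c.
have light_mono i j : (j <= i)%O -> light i -> light j.
  by move=> ji; apply: le_trans; apply: Lnorm_cutoff_le => //; exact: incrE.
have [s2 [z [s1 [sE hs2 hs1]]]] := pairwise_split_light light_mono ps s0.
move: ps; rewrite sE pairwise_cat allrel_consr /=.
move=> /and3P[/andP[/allP zs2 _] ps2 /andP[_ ps1]].
have [sz1 sz2] : (size s1 <= n)%N /\ (size s2 <= n)%N.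
  move: sn; rewrite sE size_cat /= addnS ltnS => sn.
  by split; apply: leq_trans sn; rewrite ?leq_addl ?leq_addr.
pose B := (ck_const * A)%:E * c.
have B0 : 0 <= B.
  apply: mule_ge0; first by rewrite lee_fin mulr_ge0// ltW.
  by apply: mule_ge0; [rewrite lee_fin powR_ge0|exact: Lnorm_ge0].
have scale (g : Y -> K) : 'N[nu]_p[absf g] <= c ->
    (ck_const * A)%:E * 'N[nu]_p[absf g] <= B.
  by apply: lee_wpmul2l; rewrite lee_fin mulr_ge0// ltW.
have Lc D : measurable D -> Lp nu p (cutoff f D) by move=> mD; exact: Lp_cutoff.
have mz : measurable (~` E z) by exact: measurableC.
have M1 : 'N[mu]_q[sup_cutoff E [set` s1] S f] <= B.
  case: s1 => [|y s1] in sz1 ps1 hs1 {sE} *; first by rewrite N0.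
  (* The head [y] is the largest index of this list, so [f] may be replaced by [f 1_(E y)], whose
     norm is at most [c]. *)
  have -> : sup_cutoff E [set` y :: s1] S f =
            sup_cutoff E [set` y :: s1] S (cutoff f (E y)).
    apply/funext => x; congr ereal_sup; congr (_ `|` _).
    apply: eq_imagel => i /= iy; rewrite cutoffI setIidr//; apply: incrE.
    move: iy; rewrite inE => /predU1P[->//|]; move: ps1 => /= /andP[/allP h _].
    exact: h.
  apply: le_trans _ (scale _ (hs1 _ _ erefl)); apply: IH => //; exact: Lc.
have M2 : 'N[mu]_q[sup_cutoff E [set` s2] S (cutoff f (~` E z))] <= B.
  case: hs2 => [->|nl]; first by rewrite N0.
  have py : p < +oo by exact: lt_le_trans pq (leey _).
  (* Here [E z] is heavy, so the complement is the part with at most half of the mass. *)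
  have [lz|lz] := Lnorm_cutoff_half p1 py (mE z) Lf.
    by rewrite /light lz in nl.
  apply: le_trans _ (scale _ lz); apply: IH => //; exact: Lc.
pose M x : \bar R := maxe (sup_cutoff E [set` s1] S f x)
                 (sup_cutoff E [set` s2] S (cutoff f (~` E z)) x).
have cs (r : seq I) : countable [set` r].
  exact/finite_set_countable/finite_seq.
have mM : measurable_fun setT M.
  by apply: measurable_maxe; apply: measurable_sup_cutoff => //; exact: Lc.
have M0 x : 0 <= M x by rewrite le_max sup_cutoff_ge0.
have mSz : measurable_fun setT (S (cutoff f (E z))).
  by apply: (sublinear_measurable sS); exact: Lc.
(* For [i] in [s2], [E z] lies inside [E i], and [f 1_(E i)] splits into [f 1_(E z)] and a cutoff of
   [f 1_(~ E z)]. The index [z] needs only the first term, those of [s1] only [M]. *)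
have SM : \forall x \ae mu, sup_cutoff E [set` s] S f x <=
    S (cutoff f (E z)) x + M x.
  have : \forall x \ae mu, forall i, [set` s2] i ->
      S (cutoff f (E i)) x <= S (cutoff f (E z)) x +
        S (cutoff (cutoff f (~` E z)) (E i)) x.
    apply: ae_forall_countable => // i /= is2.
    rewrite (cutoff_split f (incrE (zs2 _ is2))).
    by apply: (sublinear_add sS); [exact: Lc|apply: Lp_cutoff => //; exact: Lc].
  apply: filterS => x h; apply: sup_cutoff_le.
    by rewrite adde_ge0// (sublinear_ge0 sS).
  move=> i; rewrite /= sE mem_cat inE => /or3P[is2|/eqP->|is1].
  - apply: le_trans (h i is2) _; apply: leeD => //.
    by rewrite le_max; apply/orP; right; exact: le_sup_cutoff.
  - by rewrite leeDl.
  - apply: (@le_trans _ _ (M x)); last by rewrite leeDr ?(sublinear_ge0 sS).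
    by rewrite le_max; apply/orP; left; exact: le_sup_cutoff.
apply: (@le_trans _ _ 'N[mu]_q[S (cutoff f (E z)) \+ M]).
  apply: le_Lnorm_ae => //.
  - exact: measurable_sup_cutoff.
  - exact: emeasurable_funD.
  apply: filterS SM => x Sx /=; rewrite -sE !gee0_abs ?sup_cutoff_ge0//.
  exact: (adde_ge0 (sublinear_ge0 sS _ _) (M0 x)).
have q1 : 1 <= q by exact: le_trans p1 (ltW pq).
apply: le_trans (Lnorm_add_le mu q1 mSz mM) _.
have NM : 'N[mu]_q[M] <= (2 `^ fine q^-1)%:E * B.
  apply: Lnorm_max_le => //; try (by move=> x; exact: sup_cutoff_ge0);
    apply: measurable_sup_cutoff => //; exact: Lc.
have NS : 'N[mu]_q[S (cutoff f (E z))] <= A%:E * 'N[nu]_p[absf f].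
  apply: le_trans (SA _ (Lc _ (mE z))) _; apply: lee_wpmul2l => //.
  have := Lnorm_cutoff_le p0 (mE z) measurableT (@subsetT _ _) Lf.
  by rewrite cutoffT.
apply: le_trans (leeD NS NM) _.
rewrite /B /c !muleA -!EFinM -ge0_muleDl ?lee_fin//; last first.
  by rewrite !mulr_ge0 ?powR_ge0// ltW.
rewrite -EFinD; apply: lee_wpmul2r; first exact: Lnorm_ge0.
(* Equality holds: with [t = 2^(1/q-1/p)] this is [1 + t C = C] for [C = ck_const], multiplied by
   [A]. *)
rewrite lee_fin le_eqVlt; apply/orP; left; apply/eqP.
rewrite mulrAC -powRD; last by rewrite pnatr_eq0 implybT.
have := powR_exponents_lt1; rewrite /ck_const.
set t := (2 `^ _)%R => t1; field.
by rewrite gt_eqF ?subr_gt0.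
Qed.

(** Increasing finite lists exhaust the chain, and the bound for lists does not depend on their
    length. *)
Lemma norm_bound_sup_cutoff : countable [set: I] ->
  norm_bound mu nu p q (sup_cutoff E setT S) (ck_const * A).
Proof.
have [A0 _] := normS; have q0 := q_gt0; have C0 := ck_const_gt0.
move=> cI; split; first by rewrite mulr_ge0// ltW.
move=> f Lf; have [e Ie] := countable_enumeration cI.
(* The indices enumerated before step [n], in decreasing order; repetitions are harmless as the
   order is weak. *)
pose s n := sort >=%O (pmap e (iota 0 n)).
have mem_s n i : (i \in s n) = (Some i \in map e (iota 0 n)).
  by rewrite mem_sort mem_pmap.
have -> : sup_cutoff E setT S f =
    fun x => ereal_sup (range (fun n => sup_cutoff E [set` s n] S f x)).
  apply/funext => x; apply/eqP; rewrite eq_le; apply/andP; split.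
    apply: sup_cutoff_le.
      by apply: le_ereal_sup_tmp; exists (sup_cutoff E [set` s 0%N] S f x);
        [exists 0%N | exact: sup_cutoff_ge0].
    move=> i; rewrite Ie => -[n eni].
    (* The index [e n] first enters at [s n.+1], since [s n] stops before [n]. *)
    apply: le_ereal_sup_tmp; exists (sup_cutoff E [set` s n.+1] S f x).
      by exists n.+1.
    apply: le_sup_cutoff; rewrite /= mem_s -eni; apply: map_f.
    by rewrite mem_iota ltnS leqnn.
  apply: ge_ereal_sup => _ [n _ <-].
  apply: sup_cutoff_le => [|i _]; first exact: sup_cutoff_ge0.
  exact: le_sup_cutoff.
apply: Lnorm_sup_le => //.
- by apply: mule_ge0; [rewrite lee_fin mulr_ge0// ltW|exact: Lnorm_ge0].
- move=> n; apply: measurable_sup_cutoff => //.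
  exact/finite_set_countable/finite_seq.
- by move=> n x; exact: sup_cutoff_ge0.
- move=> x m n mn; apply: sup_cutoff_le => [|i]; first exact: sup_cutoff_ge0.
  rewrite /= mem_s => /mapP[j]; rewrite mem_iota /= add0n => jm ei.
  apply: le_sup_cutoff; rewrite /= mem_s ei; apply: map_f.
  by rewrite mem_iota add0n /= (leq_trans jm).
- move=> n; apply: norm_sup_cutoff_seq (leqnn _) _ Lf.
  rewrite -sorted_pairwise; last exact: ge_trans.
  apply: sort_sorted; exact: ge_total.
Qed.

End chain.

End maximal.

(** A dependent function is determined by the codes of its values, which form a finite function into
    [nat], itself encoded by [pickle]. *)
Lemma countable_dfun (F : finType) (I : F -> Type) :
  (forall j, countable [set: I j]) -> countable [set: forall j, I j].
Proof.
move=> cI; have g j : {g : I j -> nat | injective g}.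
  apply: cid; have /countable_injP[g gi] := cI j.
  by exists g => x y; apply: gi; rewrite inE.
apply/countable_injP; exists (fun i => pickle [ffun j => sval (g j) (i j)]).
move=> x y _ _ /(pcan_inj pickleK) /ffunP xy.
apply/functional_extensionality_dep => j.
by apply: (svalP (g j)); have := xy j; rewrite !ffunE.
Qed.

(** * Several chains, treated one after the other *)

Section iterated.
Context (R : realType) (k : base_field).
Context dX (X : measurableType dX) dY (Y : measurableType dY).
Variables (mu : {measure set X -> \bar R}) (nu : {measure set Y -> \bar R}).
Variables (p q : \bar R).
Hypotheses (p1 : (1 <= p)%E) (pq : (p < q)%E).
Local Notation K := (scalar_field R k).
Context (d : nat) (disp : 'I_d -> Order.disp_t)
  (I : forall j : 'I_d, orderType (disp j)) (E : forall j : 'I_d, I j -> set Y).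
Arguments E : clear implicits.
Hypothesis cI : forall j : 'I_d, countable [set: I j].
Hypothesis mE : forall (j : 'I_d) (i : I j), measurable (E j i).
Hypothesis incrE : forall (j : 'I_d) (i i' : I j),
  (i <= i')%O -> E j i `<=` E j i'.
Variable T : (Y -> K) -> X -> K.
Hypothesis linT : linear_operator mu nu p q T.
Hypothesis bT : bounded_operator mu nu p q (fun f => absf (T f)).
Local Open Scope ereal_scope.

Lemma sublinear_absf : sublinear mu nu p (fun f => absf (T f)).
Proof.
split; [exact: bT.1|by move=> f x; exact: absf_ge0|move=> f g Lf Lg].
(* The scalar 1 turns linearity into additivity. *)
have := linear_operator_linear linT 1%R Lf Lg.
under [X in T X]eq_fun do rewrite mul1r.
apply: filterS => x /(_ Logic.I) Tfg.
by rewrite /absf Tfg mul1r -EFinD lee_fin modulusD.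
Qed.

(** Nested one-chain maximal operators: each layer is again [sublinear], so the one-chain bound
    applies to it. *)
Definition iter_sup_cutoff (s : seq 'I_d) : (Y -> K) -> X -> \bar R :=
  foldr (fun j => sup_cutoff (E j) setT) (fun f => absf (T f)) s.

Lemma sublinear_iter_sup_cutoff s : sublinear mu nu p (iter_sup_cutoff s).
Proof.
by elim: s => [|j s IH]; [exact: sublinear_absf|exact: sublinear_sup_cutoff].
Qed.

Lemma norm_bound_iter_sup_cutoff s C :
  norm_bound mu nu p q (fun f => absf (T f)) C ->
  norm_bound mu nu p q (iter_sup_cutoff s) (ck_const p q ^+ size s * C).
Proof.
move=> TC; elim: s => [|j s IH] /=; first by rewrite expr0 mul1r.
rewrite exprS -mulrA; apply: norm_bound_sup_cutoff => //.
  exact: incrE.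
exact: sublinear_iter_sup_cutoff.
Qed.

(** Choosing [i j] in each layer cuts [f] off successively, which amounts to one cutoff by the
    intersection. *)
Lemma le_iter_sup_cutoff s (i : forall j, I j) f x :
  absf (T (cutoff f (\big[setI/setT]_(j <- s) E j (i j)))) x <=
    iter_sup_cutoff s f x.
Proof.
elim: s f => [|j s IH] f; first by rewrite big_nil cutoffT.
rewrite big_cons -cutoffI; apply: le_trans (IH _) _.
exact: (le_sup_cutoff _ (I := I j)).
Qed.

Lemma measurable_maximal_operator f : Lp nu p f ->
  measurable_fun setT (maximal_operator E T f).
Proof.
move=> Lf; apply: measurable_ereal_sup_countable => [|i _].
  exact: countable_dfun.
apply: bT.1; apply: Lp_cutoff => //; first exact: lt_le_trans p1.
exact: fin_bigcap_measurable.
Qed.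

Lemma norm_bound_maximal_operator C :
  norm_bound mu nu p q (fun f => absf (T f)) C ->
  norm_bound mu nu p q (maximal_operator E T) (ck_const p q ^+ d * C).
Proof.
move=> TC; have := norm_bound_iter_sup_cutoff (enum 'I_d) TC.
rewrite size_enum_ord => -[C0 NC]; split => // f Lf; apply: le_trans (NC f Lf).
have sS := sublinear_iter_sup_cutoff (enum 'I_d).
have q0 : 0 < q by apply: lt_trans pq; exact: lt_le_trans p1.
apply: le_Lnorm_ae => //.
- exact: measurable_maximal_operator.
- exact: sublinear_measurable sS _ Lf.
apply: aeW => x; rewrite !gee0_abs ?(sublinear_ge0 sS)//; last first.
  by apply: ereal_sup_ubound; left.
apply: ge_ereal_sup => _ [->|[i _ <-]]; first exact: sublinear_ge0 sS _ _.
apply: le_trans (le_iter_sup_cutoff (enum 'I_d) i f x).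
(* All coordinates occur in [enum 'I_d], so the iterated intersection is the one in
   [maximal_operator]. *)
rewrite -bigcap_seq (_ : [set` enum 'I_d] = setT)//.
by apply/seteqP; split => j //= _; rewrite mem_enum.
Qed.

End iterated.

Theorem lemma6 (R : realType) (k : base_field)
  (dX : measure_display) (X : measurableType dX) (mu : {measure set X -> \bar R})
  (dY : measure_display) (Y : measurableType dY) (nu : {measure set Y -> \bar R})
  (d : nat) (d_gt0 : (0 < d)%N)
  (disp : 'I_d -> Order.disp_t) (I : forall j : 'I_d, orderType (disp j))
  (I_countable : forall j : 'I_d, countable [set: I j])
  (E : forall j : 'I_d, I j -> set Y)
  (E_measurable : forall (j : 'I_d) (i : I j), measurable (E j i))
  (E_increasing : forall (j : 'I_d) (i i' : I j),
    (i <= i')%O -> E j i `<=` E j i')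
  (p q : \bar R) (p_ge1 : (1 <= p)%E) (p_lt_q : (p < q)%E)
  (T : (Y -> scalar_field R k) -> (X -> scalar_field R k))
  (T_linear : linear_operator mu nu p q T)
  (T_bounded : bounded_operator mu nu p q (fun f => absf (T f))) :
  bounded_operator mu nu p q (maximal_operator E T) /\
  (operator_norm mu nu p q (maximal_operator E T) <=
    ((1 - 2 `^ (fine q^-1 - fine p^-1)) ^- d)%:E *
    operator_norm mu nu p q (fun f => absf (T f)))%E.
Proof.
have bound C : norm_bound mu nu p q (fun f => absf (T f)) C ->
    norm_bound mu nu p q (maximal_operator E T) (ck_const p q ^+ d * C).
  exact: norm_bound_maximal_operator.
split.
  split=> [f Lf|].
    exact: (measurable_maximal_operator p_ge1 I_countable E_measurable
      T_bounded).
  by have [_ [C TC]] := T_bounded; exists (ck_const p q ^+ d * C); exact: bound.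
(* The positive constant moves inside the infimum; then each admissible [C] for [T] gives the
   admissible [ck_const p q ^+ d * C]. *)
rewrite -exprVn -/(ck_const p q) /operator_norm -ereal_inf_pZl; last first.
  by apply: exprn_gt0; exact: ck_const_gt0.
apply: le_ereal_inf_tmp => _ [_ [C TC <-] <-].
by apply: ereal_inf_lbound; exists (ck_const p q ^+ d * C) => //; exact: bound.
Qed.
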